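(* Let $a,c$ be real numbers with $a\neq 0,1$ and $c\neq 0,-1,-2,\ldots$, and let $\mathcal F=(F_1,F_2)$ be a pair of finite sets of positive integers, not both empty. Then the polynomials $m_n^{\mathcal F}=m_n^{a,c;\mathcal F}$, $n\in\sigma_{\mathcal F}$, are common eigenfunctions of the second order difference operator $$D_{\mathcal F}=h_{-1}(x)\mathfrak s_{-1}+h_0(x)\mathfrak s_0+h_1(x)\mathfrak s_1,$$ where $$h_{-1}(x)=\frac{x\,\Omega_{\mathcal F}(x+1)}{(a-1)\Omega_{\mathcal F}(x)},\qquad h_1(x)=\frac{a(x+c+k)\,\Omega_{\mathcal F}(x)}{(a-1)\Omega_{\mathcal F}(x+1)},$$ $$h_0(x)=-\frac{(1+a)(x+k)+ac}{a-1}+u_{\mathcal F}+\Delta\left(\frac{a(x+c+k-1)\Lambda_{\mathcal F}(x)}{(a-1)\Omega_{\mathcal F}(x)}\right).$$ Moreover $D_{\mathcal F}(m_n^{\mathcal F})=n\,m_n^{\mathcal F}$ for all $n\in\sigma_{\mathcal F}$.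
   Context: $\mathbb N=\{0,1,2,\ldots\}$. Shift operators: $\mathfrak s_l f(x)=f(x+l)$. $\Delta f(x)=f(x+1)-f(x)$. Meixner polynomials: for $a\ne 0,1$, $m_n^{a,c}(x)=\frac{a^n}{(1-a)^n}\sum_{j=0}^n a^{-j}\binom{x}{j}\binom{-x-c}{n-j}$. For a pair $\mathcal F=(F_1,F_2)$ of finite sets of positive integers, let $k_i=|F_i|$, $k=k_1+k_2$, $$u_{\mathcal F}=\sum_{f\in F_1}f+\sum_{f\in F_2}f-\binom{k_1+1}{2}-\binom{k_2}{2},\qquad \sigma_{\mathcal F}=\{u_{\mathcal F},u_{\mathcal F}+1,\ldots\}\setminus\{u_{\mathcal F}+f: f\in F_1\}.$$ For $n\in\sigma_{\mathcal F}$, $m_n^{a,c;\mathcal F}(x)$ is the determinant of the $(k+1)\times(k+1)$ matrix with columns indexed by $j=0,1,\ldots,k$ whose rows are, from top to bottom: the row $\big(m_{n-u_{\mathcal F}}^{a,c}(x+j)\big)_j$; then, for each $f\in F_1$ in increasing order, the row $\big(m_f^{a,c}(x+j)\big)_j$; then, for each $f\in F_2$ in increasing order, the row $\big(m_f^{1/a,c}(x+j)/a^j\big)_j$. $\Omega_{\mathcal F}(x)=\Omega_{\mathcal F}^{a,c}(x)$ is the determinant of the $k\times k$ matrix with columns indexed by $j=0,1,\ldots,k-1$ whose rows are $\big(m_f^{a,c}(x+j)\big)_j$ for $f\in F_1$ (increasing order), followed by $\big(m_f^{1/a,c}(x+j)/a^j\big)_j$ for $f\in F_2$ (increasing order). $\Lambda_{\mathcal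 F}(x)=\Lambda_{\mathcal F}^{a,c}(x)$ is the determinant of the $k\times k$ matrix defined in the same way but with columns indexed by $j=0,1,\ldots,k-2,k$ (the index $k-1$ is skipped and replaced by $k$). ($\Omega_{\mathcal F}$ is a nonzero polynomial, so the coefficients above are rational functions.) *)

(* Defs.v *)
From HB Require Import structures.
From mathcomp Require Import all_boot all_order all_algebra.
From mathcomp Require Import finmap.

Set Implicit Arguments.
Unset Strict Implicit.
Unset Printing Implicit Defensive.

Import GRing.Theory.
Local Open Scope ring_scope.

Notation "p %:F" := (@FracField.tofrac _ p) : ring_scope.

Section Shifts.
Variable K : fieldType.
Implicit Types (l : K) (p q : {poly K}) (g : {fraction {poly K}}).

(* p(x + l) *)
Definition pshift l p : {poly K} := p \Po ('X + l%:P).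

(* The shift acts on K(x) through any representation as a quotient of
   polynomials; see fshift_div for the independence of the representative. *)
Definition fshift l g : {fraction {poly K}} :=
  (pshift l \n_(repr g))%:F / (pshift l \d_(repr g))%:F.

Definition fdelta g : {fraction {poly K}} := fshift 1 g - g.

Lemma pshift_eq0 l p : (pshift l p == 0) = (p == 0).
Proof. by rewrite /pshift -size_poly_eq0 size_comp_poly2 ?size_XaddC // size_poly_eq0. Qed.

Lemma fracE g : g = (\n_(repr g))%:F / (\d_(repr g))%:F.
Proof.
have d0 : \d_(repr g) != 0 by exact: denom_ratioP.
apply: (mulIf (x := (\d_(repr g))%:F)); first by rewrite tofrac_eq0.
rewrite divfK ?tofrac_eq0 //.
rewrite -{1}[g]reprK; unlock FracField.tofrac; rewrite -[LHS]FracField.pi_mul.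
apply/eqmodP; rewrite /= FracField.equivfE /FracField.mulf.
rewrite !numden_Ratio ?mulf_neq0 ?oner_eq0 //.
by rewrite !mulr1 mulrC.
Qed.

Lemma fshift_div l p q :
  q != 0 -> fshift l (p%:F / q%:F) = (pshift l p)%:F / (pshift l q)%:F.
Proof.
move=> q0; rewrite /fshift; set g := p%:F / q%:F.
have d0 : \d_(repr g) != 0 by exact: denom_ratioP.
have /eqP := fracE g; rewrite {1}/g eqr_div ?tofrac_eq0 // -!tofracM tofrac_eq.
move=> /eqP e; apply/eqP; rewrite eqr_div ?tofrac_eq0 ?pshift_eq0 //.
by rewrite -!tofracM tofrac_eq /pshift -!comp_polyM e.
Qed.

End Shifts.

Section Meixner.
Variable K : fieldType.
Implicit Types (a c : K).

(* The generalized binomial coefficient p (p - 1) ... (p - j + 1) / j!,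
   for p a polynomial. *)
Definition polybin (p : {poly K}) (j : nat) : {poly K} :=
  (j`!%:R)^-1 *: \prod_(i < j) (p - (i%:R)%:P).

Definition meixner a c (n : nat) : {poly K} :=
  (a ^+ n / (1 - a) ^+ n) *:
  \sum_(j < n.+1)
    a ^- j *: (polybin 'X j * polybin (- 'X - c%:P) (n - j)).

End Meixner.

Section Index.
Implicit Types F : {fset nat} * {fset nat}.
Local Open Scope nat_scope.

Definition k_of F : nat := #|` F.1| + #|` F.2|.

(* No truncation occurs in these subtractions when the elements of F.1 and F.2
   are positive, since then sum F.1 >= 'C(k1.+1, 2) and sum F.2 >= 'C(k2, 2). *)
Definition u_of F : nat :=
  \sum_(f <- F.1) f + \sum_(f <- F.2) f
    - 'C(#|` F.1|.+1, 2) - 'C(#|` F.2|, 2).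

Definition sigma F : pred nat :=
  [pred n | (u_of F <= n) && (n \notin [fset (u_of F + f)%N | f in F.1]%fset)].

End Index.

Section ExceptionalMeixner.
Variable K : fieldType.
Implicit Types (a c : K) (F : {fset nat} * {fset nat}).

(* A row is represented by the function mapping the column index j to the
   entry, a polynomial in x. *)
Definition row_F1 a c (f : nat) : nat -> {poly K} :=
  fun j => pshift j%:R (meixner a c f).

Definition row_F2 a c (f : nat) : nat -> {poly K} :=
  fun j => a ^- j *: pshift j%:R (meixner a^-1 c f).

Definition rows a c F : seq (nat -> {poly K}) :=
  [seq row_F1 a c f | f <- sort leq F.1] ++ [seq row_F2 a c f | f <- sort leq F.2].

Definition rows_mx (s : seq (nat -> {poly K})) (col : nat -> nat) :
    'M[{poly K}]_(size s) :=
  \matrix_(i, j) nth (fun=> 0) s i (col j).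

Definition Omega a c F : {poly K} := \det (rows_mx (rows a c F) id).

(* bump (k - 1) maps 0, ..., k - 1 to 0, ..., k - 2, k. *)
Definition Lambda a c F : {poly K} :=
  \det (rows_mx (rows a c F) (bump (k_of F).-1)).

Definition xmeixner a c F (n : nat) : {poly K} :=
  \det (rows_mx (row_F1 a c (n - u_of F) :: rows a c F) id).

Definition h_m1 a c F : {fraction {poly K}} :=
  ('X * pshift 1 (Omega a c F))%:F / ((a - 1) *: Omega a c F)%:F.

Definition h_1 a c F : {fraction {poly K}} :=
  (a *: ('X + c%:P + (k_of F)%:R%:P) * Omega a c F)%:F
    / ((a - 1) *: pshift 1 (Omega a c F))%:F.

Definition h_0 a c F : {fraction {poly K}} :=
  - (((1 + a) *: ('X + (k_of F)%:R%:P) + (a * c)%:P)%:F / (a - 1)%:P%:F)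
  + (u_of F)%:R
  + fdelta ((a *: ('X + c%:P + (k_of F)%:R%:P - 1) * Lambda a c F)%:F
             / ((a - 1) *: Omega a c F)%:F).

Definition D_op a c F (g : {fraction {poly K}}) : {fraction {poly K}} :=
  h_m1 a c F * fshift (- 1) g + h_0 a c F * fshift 0 g
    + h_1 a c F * fshift 1 g.

Definition poly_eigenfunction (T : {fraction {poly K}} -> {fraction {poly K}})
    (lam : K) (p : {poly K}) : Prop :=
  p != 0 /\ T p%:F = (lam *: p)%:F.

End ExceptionalMeixner.

(* Main.v *)
(* Write phi_1, ..., phi_k for the functions m_f^{a,c}(x), f in F_1, and
   a^{-x} m_f^{1/a,c}(x), f in F_2. All are eigenfunctions of the Meixner
   operator D, and T : psi |-> Cas(psi, phi_1, ..., phi_k) is a difference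
   operator of order k which kills every phi_i and whose lowest and two highest
   coefficients are Omega(x + 1), Lambda(x) and Omega(x), up to constants. The
   functions h_{-1}, h_1, h_0 are exactly those for which D_F T - T (D + u) has
   no term in s_{-1}, s_k, s_{k+1}. What remains involves only s_0, ..., s_{k-1}
   and kills the k functions phi_i, whose Casoratian Omega is nonzero; so
   D_F T = T (D + u), and applying this to m_{n-u} gives the eigenvalue n. *)
Require Import Defs.
From HB Require Import structures.
From mathcomp Require Import all_boot all_order all_algebra.
From mathcomp Require Import finmap reals.
From mathcomp Require Import ring.

Set Implicit Arguments.
Unset Strict Implicit.

Import GRing.Theory Num.Theory.
Local Open Scope ring_scope.

(** * Shifts of polynomials and rational functions of period one *)

Section Shift.
Variable K : numFieldType.
Implicit Types (p q : {poly K}) (l : K).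

Lemma pshiftD l p q : pshift l (p + q) = pshift l p + pshift l q.
Proof. exact: comp_polyD. Qed.

Lemma pshiftM l p q : pshift l (p * q) = pshift l p * pshift l q.
Proof. exact: comp_polyM. Qed.

Lemma pshiftZ l (b : K) p : pshift l (b *: p) = b *: pshift l p.
Proof. exact: comp_polyZ. Qed.

Lemma pshift_sum l (I : Type) (r : seq I) (P : pred I) (E : I -> {poly K}) :
  pshift l (\sum_(i <- r | P i) E i) = \sum_(i <- r | P i) pshift l (E i).
Proof. exact: raddf_sum. Qed.

Lemma pshiftC l (b : K) : pshift l b%:P = b%:P.
Proof. exact: comp_polyC. Qed.

Lemma pshiftX l : pshift l 'X = 'X + l%:P.
Proof. exact: comp_polyX. Qed.

Lemma pshift_pshift l l' p : pshift l (pshift l' p) = pshift (l + l') p.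
Proof.
by rewrite /pshift -comp_polyA comp_polyD comp_polyX comp_polyC polyCD addrA.
Qed.

Lemma pshift0 p : pshift 0 p = p.
Proof. by rewrite /pshift addr0 comp_polyXr. Qed.

Lemma horner_pshift l p x : (pshift l p).[x] = p.[x + l].
Proof. by rewrite horner_comp !hornerE. Qed.

Lemma lead_coef_pshift l p : lead_coef (pshift l p) = lead_coef p.
Proof. by rewrite lead_coef_comp ?size_XaddC // lead_coefXaddC expr1n mulr1. Qed.

Lemma det_pshift l n (M : 'M[{poly K}]_n) :
  \det (map_mx (pshift l) M) = pshift l (\det M).
Proof. exact: det_map_mx. Qed.

(** In characteristic zero the points x, x + 1, ... are distinct, and a nonzero p has finitely many
    roots. *)
Lemma poly_neq0_nat_nonroot p (x : K) :
  p != 0 -> exists m : nat, p.[x + m%:R] != 0.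
Proof.
move=> pn0.
suff /hasP[m _ pm] : has (fun m => p.[x + m%:R] != 0) (iota 0 (size p)).
  by exists m.
apply: contraNT pn0 => /hasPn H; apply/negPn/negP => pn0.
have := @max_poly_roots _ p [seq x + m%:R | m <- iota 0 (size p)] pn0.
rewrite size_map size_iota ltnn => H'; suff: false by []; apply: H'.
  by apply/allP => _ /mapP[m /H /negPn ? ->].
rewrite map_inj_uniq ?iota_uniq // => m n /addrI/eqP.
by rewrite eqr_nat => /eqP.
Qed.

(** The quotient p/q has period 1. With b its value at a point x where q does not vanish, p - b q
    vanishes at x + m for every natural m, hence identically. *)
Lemma pshift_ratio_const p q :
    q != 0 -> pshift 1 p * q = p * pshift 1 q -> exists b : K, p = b *: q.
Proof.
move=> q0 e.
have em (m : nat) : pshift m%:R p * q = p * pshift m%:R q.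
  elim: m => [|m IH]; first by rewrite !pshift0.
  have qm0 : pshift m%:R q != 0 by rewrite pshift_eq0.
  have em := congr1 (pshift m%:R) e.
  rewrite !pshiftM !pshift_pshift natr1 in em.
  apply: (mulIf qm0); rewrite mulrAC em mulrAC IH; ring.
have [x qx] : exists x, q.[x] != 0.
  by have [n qn] := poly_neq0_nat_nonroot 0 q0; exists (0 + n%:R).
exists (p.[x] / q.[x]); apply/eqP; rewrite -subr_eq0; apply/negPn/negP.
move=> /(poly_neq0_nat_nonroot x) [m /eqP[]].
have := congr1 (horner^~ x) (em m); rewrite !hornerM !horner_pshift => H.
by rewrite hornerD hornerN hornerZ -[p.[x + m%:R]](mulfK qx) H; ring.
Qed.

End Shift.

(** * Generalized binomial coefficients *)

Section PolyBin.
Variable K : numFieldType.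
Implicit Types (p q : {poly K}).

Lemma pshift_polybin (l : K) p j :
  pshift l (polybin p j) = polybin (pshift l p) j.
Proof.
rewrite /polybin pshiftZ; congr (_ *: _).
rewrite /pshift rmorph_prod; apply: eq_bigr => i _.
by rewrite /= comp_polyB comp_polyC.
Qed.

Lemma polybin0 p : polybin p 0 = 1.
Proof. by rewrite /polybin big_ord0 invr1 scale1r. Qed.

Lemma polybinS p j :
  (j.+1)%:R *: polybin p j.+1 = (p - j%:R%:P) * polybin p j.
Proof.
rewrite /polybin big_ord_recr /= scalerA factS natrM invfM mulrA divff ?pnatr_eq0 //.
by rewrite mul1r mulrC -scalerAr.
Qed.

Lemma polybinSl p j :
  (j.+1)%:R *: polybin p j.+1 = p * polybin (p - 1) j.
Proof.
rewrite /polybin big_ord_recl /= scalerA factS natrM invfM mulrA divff ?pnatr_eq0 //.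
rewrite mul1r -scalerAr subr0; congr (_ *: (_ * _)); apply: eq_bigr => i _.
by rewrite /bump leq0n add1n -natr1 polyCD; ring.
Qed.

Lemma polybin_pascal p j :
  polybin (p + 1) j.+1 = polybin p j.+1 + polybin p j.
Proof.
have nz : (j.+1)%:R != 0 :> K by rewrite pnatr_eq0.
apply: (scalerI nz); rewrite polybinSl addrK scalerDr polybinS.
by rewrite -[_ *: polybin p j]mul_polyC -natr1 polyCD; ring.
Qed.

End PolyBin.

(** * Weighted Vandermonde convolutions *)

Section Vandermonde.
Variable K : numFieldType.
Implicit Types (al be : K) (u v : {poly K}).

(** This is the coefficient of t^n in (1 + al t)^u (1 + be t)^v. *)
Definition polyvdm al be u v n : {poly K} :=
  \sum_(j < n.+1) (al ^+ j * be ^+ (n - j)) *: (polybin u j * polybin v (n - j)).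

Lemma polyvdmC al be u v n : polyvdm al be u v n = polyvdm be al v u n.
Proof.
rewrite /polyvdm (reindex_inj rev_ord_inj) /=; apply: eq_bigr => j _.
by rewrite subSS subKn -1?ltnS // [in LHS]mulrC [X in _ *: X]mulrC.
Qed.

(** The factor j is t d/dt acting on (1 + al t)^u, whose derivative is al u (1 + al t)^(u - 1). *)
Lemma polyvdm_euler al be u v n :
  \sum_(j < n.+2) (j%:R * (al ^+ j * be ^+ (n.+1 - j))) *:
     (polybin u j * polybin v (n.+1 - j))
  = al *: (u * polyvdm al be (u - 1) v n).
Proof.
rewrite big_ord_recl mul0r scale0r add0r /polyvdm mulr_sumr scaler_sumr.
apply: eq_bigr => j _; rewrite lift0 subSS.
have := polybinSl u j; rewrite -!mul_polyC; rewrite exprS; move: j.+1%:R => k H; ring: H.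
Qed.

(** The product rule: n + 1 = j + (n + 1 - j) splits t d/dt between the two factors. *)
Lemma polyvdm_eulerD al be u v n :
  n.+1%:R *: polyvdm al be u v n.+1 =
  al *: (u * polyvdm al be (u - 1) v n) + be *: (v * polyvdm al be u (v - 1) n).
Proof.
rewrite (polyvdmC _ _ u (v - 1)) -!polyvdm_euler.
rewrite [X in _ = _ + X](reindex_inj rev_ord_inj) -big_split /= scaler_sumr.
apply: eq_bigr => j _; have lejn : (j <= n.+1)%N by rewrite -ltnS.
rewrite subSS subKn // [polybin v _ * _]mulrC [be ^+ _ * _]mulrC scalerA -scalerDl.
by rewrite -mulrDl -natrD subnKC.
Qed.

(** The two generating functions differ by (1 + al t)^(u - 1) (1 + be t)^v times (1 + be t) - (1 +
    al t) = (be - al) t. The factor u produces a term of [polyvdm_eulerD]. *)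
Lemma polyvdm_shift al be u v n :
  u * (polyvdm al be (u - 1) (v + 1) n.+1 - polyvdm al be u v n.+1)
  = (be - al) *: (u * polyvdm al be (u - 1) v n).
Proof.
pose g u' v' j := (al ^+ j * be ^+ (n - j)) *: (polybin u' j * polybin v' (n - j)).
have L : polyvdm al be (u - 1) (v + 1) n.+1 =
    \sum_(j < n.+2) (al ^+ j * be ^+ (n.+1 - j)) *:
      (polybin (u - 1) j * polybin v (n.+1 - j))
    + be *: polyvdm al be (u - 1) v n.
  rewrite /polyvdm big_ord_recr [in RHS]big_ord_recr /= subnn !polybin0.
  rewrite addrAC; congr (_ + _); rewrite scaler_sumr -big_split /=.
  apply: eq_bigr => j _; rewrite subSn -1?ltnS // polybin_pascal.
  by rewrite mulrDr scalerDr scalerA exprS mulrCA.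
have R : polyvdm al be u v n.+1 =
    \sum_(j < n.+2) (al ^+ j * be ^+ (n.+1 - j)) *:
      (polybin (u - 1) j * polybin v (n.+1 - j))
    + al *: polyvdm al be (u - 1) v n.
  rewrite /polyvdm big_ord_recl [in RHS]big_ord_recl /= !polybin0.
  rewrite -addrA; congr (_ + _); rewrite scaler_sumr -big_split /=.
  apply: eq_bigr => j _; rewrite /bump leq0n add1n subSS -{1}[u](subrK 1) polybin_pascal.
  by rewrite mulrDl scalerDr scalerA exprS mulrA.
by rewrite L R -!mul_polyC polyCB; ring.
Qed.

End Vandermonde.

(** * Difference equation and degree of the Meixner polynomials *)

Section MeixnerEquation.
Variable K : numFieldType.
Implicit Types (a c : K).

Lemma meixnerE a c n :
  meixner a c n =
  (a ^+ n / (1 - a) ^+ n) *: polyvdm a^-1 1 'X (- 'X - c%:P) n.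
Proof.
rewrite /meixner /polyvdm; congr (_ *: _); apply: eq_bigr => j _.
by rewrite expr1n mulr1 exprVn.
Qed.

(** With y = -x - c, shifting x by -1 or 1 turns (x, y) into (x - 1, y + 1) or (x + 1, y - 1), which
    is [polyvdm_shift] or its mirror image. The two contributions add up by [polyvdm_eulerD]. *)
Lemma meixner_diff_eq a c n : a != 0 ->
  'X * pshift (- 1) (meixner a c n)
  - ((1 + a) *: 'X + (a * c)%:P) * meixner a c n
  + a *: (('X + c%:P) * pshift 1 (meixner a c n))
  = (n%:R * (a - 1)) *: meixner a c n.
Proof.
move=> a0; rewrite meixnerE !pshiftZ.
set C := a ^+ n / _; set y := - 'X - c%:P.
have sh l : pshift l (polyvdm a^-1 1 'X y n) = polyvdm a^-1 1 ('X + l%:P) (y - l%:P) n.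
  rewrite /polyvdm pshift_sum; apply: eq_bigr => j _.
  rewrite pshiftZ pshiftM !pshift_polybin pshiftX; congr (_ *: (_ * polybin _ _)).
  rewrite {1}/y /pshift raddfB raddfN /= comp_polyX comp_polyC /y; ring.
rewrite !sh polyCN opprK.
case: n @C {sh} => [|n] C.
  rewrite mul0r scale0r /polyvdm !big_ord1 !polybin0 -!mul_polyC !polyCM; ring.
have e1 := polyvdm_shift a^-1 1 'X y n.
have e2 := polyvdm_shift 1 a^-1 y 'X n.
have e3 := polyvdm_eulerD a^-1 1 'X y n.
rewrite !(polyvdmC 1) in e2; rewrite polyC1.
move: (polyvdm _ _ ('X - 1) (y + 1) n.+1) (polyvdm _ _ ('X + 1) _ n.+1) e1 e2.
move: (polyvdm _ _ _ _ n.+1) (polyvdm _ _ _ _ n) (polyvdm _ _ ('X - 1) _ n) e3.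
move=> S P1 P2 e3 P3 P4 e1 e2.
(* The three coefficients x, -(1 + a) x - a c and a (x + c) = -a y sum to 0, so only differences
   with [S] occur. *)
transitivity (C *: ('X * (P3 - S)) - (a * C) *: (y * (P4 - S))).
  by rewrite /y -!mul_polyC; ring.
have -> : (n.+1%:R * (a - 1)) *: (C *: S) = ((a - 1) * C) *: (n.+1%:R *: S).
  by rewrite !scalerA; congr (_ *: _); ring.
rewrite e1 e2 e3 scale1r scalerDr !scalerA.
have -> : C * (1 - a^-1) = (a - 1) * C * a^-1 by field.
have -> : a * C * (a^-1 - 1) = - ((a - 1) * C) by field.
by rewrite scaleNr opprK.
Qed.

Lemma size_coefM_top (p q : {poly K}) (m n : nat) :
  (size p <= m.+1)%N -> (size q <= n.+1)%N ->
  (size (p * q)%R <= (m + n).+1)%N /\ (p * q)`_(m + n) = p`_m * q`_n.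
Proof.
move=> sp sq; split.
  apply: leq_trans (size_polyMleq _ _) _.
  by rewrite -subn1 leq_subLR add1n -addnS -addSn leq_add.
have lt : (m < (m + n).+1)%N by rewrite ltnS leq_addr.
rewrite coefM (bigD1 (Ordinal lt)) //= addKn big1 ?addr0 // => i neq.
have [lt_im|gt_im|] := ltngtP i m; last by move=> e; rewrite -val_eqE /= e eqxx in neq.
  by rewrite [q`__]nth_default ?mulr0 // (leq_trans sq) // ltn_subRL ltn_add2r.
by rewrite nth_default ?mul0r // (leq_trans sp).
Qed.

Lemma size_coef_polybin (p : {poly K}) (j : nat) : (size p <= 2)%N ->
  (size (polybin p j) <= j.+1)%N /\ (polybin p j)`_j = p`_1 ^+ j / j`!%:R.
Proof.
move=> sp; rewrite /polybin coefZ [_ / _]mulrC.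
suff [s1 s2] : (size (\prod_(i < j) (p - i%:R%:P))%R <= j.+1)%N /\
    (\prod_(i < j) (p - i%:R%:P))`_j = p`_1 ^+ j.
  by rewrite s2 (leq_trans (size_scale_leq _ _)).
elim: j => [|j [s1 s2]]; first by rewrite big_ord0 size_poly1 coef1.
rewrite big_ord_recr /= -[j.+1]addn1.
have sp' : (size (p - j%:R%:P)%R <= 2)%N.
  by rewrite (leq_trans (size_polyD _ _)) // geq_max sp size_polyN (leq_trans (size_polyC_leq1 _)).
have [t1 t2] := size_coefM_top s1 sp'.
by rewrite t1 t2 s2 coefB coefC subr0 addn1 exprSr.
Qed.

(** Up to the prefactor, the binomial theorem sums the coefficients of x^n to (1/a - 1)^n / n!,
    which is nonzero. *)
Lemma size_meixner a c n : a != 0 -> a != 1 -> size (meixner a c n) = n.+1.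
Proof.
move=> a0 a1; have a1' : 1 - a != 0 by rewrite subr_eq0 eq_sym.
rewrite meixnerE size_scale ?mulf_neq0 ?invr_neq0 ?expf_neq0 //.
set y := - 'X - c%:P.
have sX : (size ('X : {poly K}) <= 2)%N by rewrite size_polyX.
have sy : (size y <= 2)%N.
  by rewrite /y -opprD size_polyN size_XaddC.
have st j : (j <= n)%N -> (size (polybin 'X j * polybin y (n - j))%R <= n.+1)%N /\
     (polybin 'X j * polybin y (n - j))`_n = (-1) ^+ (n - j) / (j`!%:R * (n - j)`!%:R).
  move=> lejn; have [s1 s2] := size_coef_polybin j sX.
  have [t1 t2] := size_coef_polybin (n - j) sy.
  have [r1 r2] := size_coefM_top s1 t1; rewrite subnKC // in r1 r2.
  split=> //; rewrite r2 s2 t2 coefX expr1n mul1r /y !coefB coefN coefX coefC subr0.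
  by rewrite invfM mulrCA.
apply/eqP; rewrite eqn_leq; apply/andP; split.
  apply/leq_sizeP => i lti; rewrite coef_sum big1 // => j _.
  rewrite coefZ nth_default ?mulr0 //.
  by apply: leq_trans lti; have [] := st j (ltn_ord j).
rewrite ltnNge; apply/negP => /leq_sizeP /(_ n (leqnn _)) /eqP; apply/negP.
have nf : n`!%:R != 0 :> K by rewrite pnatr_eq0 -lt0n fact_gt0.
have -> : (polyvdm a^-1 1 'X y n)`_n = (a^-1 - 1) ^+ n / n`!%:R.
  rewrite coef_sum addrC exprDn mulr_suml; apply: eq_bigr => j _.
  have lejn : (j <= n)%N by rewrite -ltnS.
  have [_ e] := st _ lejn; rewrite coefZ e expr1n mulr1 -(bin_fact lejn) !natrM.
  have n1 : j`!%:R != 0 :> K by rewrite pnatr_eq0 -lt0n fact_gt0.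
  have n2 : (n - j)`!%:R != 0 :> K by rewrite pnatr_eq0 -lt0n fact_gt0.
  have n3 : 'C(n, j)%:R != 0 :> K by rewrite pnatr_eq0 -lt0n bin_gt0.
  by rewrite -mulr_natr; field; rewrite n1 n2 n3.
rewrite mulf_neq0 ?invr_neq0 // expf_neq0 // subr_eq0.
by apply: contra a1 => /eqP e; rewrite -[a]invrK e invr1.
Qed.

End MeixnerEquation.

(** * Nonvanishing of Casoratians *)

Section Casoratian.
Variable K : numFieldType.

(** The Casorati matrix of the functions mu_i^x p_i(x), with mu_i^x divided out of row i so that the
    entries are polynomials. *)
Definition casorati n (mu : 'I_n -> K) (p : 'I_n -> {poly K}) :
    'M[{poly K}]_n :=
  \matrix_(i, j) (mu i ^+ j *: pshift j%:R (p i)).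

(** Among the terms with nonzero coefficient, the one of largest degree is unique, so its leading
    term cannot cancel. *)
Lemma lin_indep_of_size n (p : 'I_n -> {poly K}) (b : 'I_n -> K) :
  (forall i, p i != 0) ->
  (forall i j, b i != 0 -> b j != 0 -> size (p i) = size (p j) -> i = j) ->
  \sum_i b i *: p i = 0 -> forall i, b i = 0.
Proof.
move=> p0 inj sum0 i0; apply/eqP/negPn/negP => bi0.
case: (@arg_maxnP _ i0 (fun i => b i != 0) (fun i => size (p i)) bi0) => i bi max_i.
have := congr1 (fun q : {poly K} => q`_(size (p i)).-1) sum0.
rewrite coef_sum coef0 (bigD1 i) //= big1 => [|j neq]; last first.
  rewrite coefZ; have [-> |bj] := eqVneq (b j) 0; first by rewrite mul0r.
  rewrite nth_default ?mulr0 // -ltnS prednK ?size_poly_gt0 //.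
  rewrite ltn_neqAle [(_ <= _)%N]max_i // andbT; apply: contra neq => /eqP e.
  by rewrite (inj j i).
by rewrite addr0 coefZ => /eqP; rewrite mulf_eq0 (negPf bi) -lead_coefE lead_coef_eq0 (negPf (p0 i)).
Qed.

(* In a vanishing Casoratian of minimal size the cofactors C_i of the last
   column are nonzero and annihilate all columns; comparing this relation with
   its shift shows that C_i / C_0 is a rational solution of
   y(x + 1) = (mu_i / mu_0) y(x). Hence mu_i = mu_0 and C_i / C_0 is constant. *)
Lemma det_casorati_neq0 n (mu : 'I_n -> K) (p : 'I_n -> {poly K}) :
  (forall i, mu i != 0) -> (forall i, p i != 0) ->
  (forall i j, mu i = mu j -> size (p i) = size (p j) -> i = j) ->
  \det (casorati mu p) != 0.
Proof.
elim: n mu p => [|n IH] mu p mu0 p0 inj; first by rewrite det_mx00 oner_eq0.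
have sub0 i0 : \det (casorati (mu \o lift i0) (p \o lift i0)) != 0.
  apply: IH => //= i j e1 e2; exact: lift_inj (inj _ _ e1 e2).
apply/negP => /eqP det0.
set M := casorati mu p in det0.
pose C i := cofactor M i ord_max.
have C0 i : C i != 0.
  rewrite /C /cofactor mulf_neq0 ?expf_neq0 ?oppr_eq0 ?oner_eq0 //.
  suff -> : row' i (col' ord_max M) = casorati (mu \o lift i) (p \o lift i) by [].
  by apply/matrixP => i' j'; rewrite !mxE /= /bump leqNgt ltn_ord.
have rel (j : nat) : (j <= n)%N -> \sum_i C i * (mu i ^+ j *: pshift j%:R (p i)) = 0.
  rewrite -ltnS => ltj; have := congr1 (fun A : 'M_n.+1 => A ord_max (Ordinal ltj)) (mul_adj_mx M).
  rewrite det0 -scalemx1 scale0r !mxE => e; rewrite -[RHS]e; apply: eq_bigr => i _.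
  by rewrite !mxE.
clearbody C; pose d i := mu ord0 *: (C ord0 * pshift 1 (C i)) - mu i *: (pshift 1 (C ord0) * C i).
have d0 : d ord0 = 0 by rewrite /d mulrC subrr.
(* Subtracting C_0(x + 1) times relation j + 1 from mu_0 C_0(x) times the shift of relation j
   cancels the term i = 0. *)
have reld (j : nat) : (j < n)%N ->
    \sum_(i < n) d (lift ord0 i) *
      (mu (lift ord0 i) ^+ j *: pshift 1 (pshift j%:R (p (lift ord0 i)))) = 0.
  move=> ltj; have := congr1 (fun q => mu ord0 *: (C ord0 * pshift 1 q)) (rel j (ltnW ltj)).
  have := congr1 ( *%R (pshift 1 (C ord0))) (rel j.+1 ltj).
  rewrite !mulr0 pshift_sum !mulr_sumr scaler_sumr => e1.
  rewrite [pshift 1 0]comp_poly0 mulr0 scaler0 => e2.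
  have := congr2 (fun q1 q2 => q1 - q2) e2 e1.
  rewrite /= subr0 -sumrB big_ord_recl.
  set h := (X in X + _); have -> : h = 0.
    rewrite /h pshiftM !pshiftZ pshift_pshift nat1r exprS -!mul_polyC; ring.
  rewrite add0r => e; rewrite -[RHS]e; apply: eq_bigr => i _.
  rewrite /d pshiftM !pshiftZ pshift_pshift nat1r exprS -!mul_polyC; ring.
have dlift i : d (lift ord0 i) = 0.
  pose v := \row_(i < n) d (lift ord0 i).
  pose N := map_mx (pshift 1) (casorati (mu \o lift ord0) (p \o lift ord0)).
  have vN : v *m N = 0.
    apply/rowP => j; rewrite !mxE -[RHS](reld j (ltn_ord j)).
    by apply: eq_bigr => i' _; rewrite !mxE pshiftZ.
  have : \det N *: v = 0 by rewrite -mul_mx_scalar -mul_mx_adj mulmxA vN mul0mx.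
  move/rowP/(_ i)/eqP; rewrite !mxE mulf_eq0 /N det_pshift pshift_eq0.
  by rewrite (negPf (sub0 _)) => /eqP.
have di i : mu ord0 *: (C ord0 * pshift 1 (C i)) = mu i *: (pshift 1 (C ord0) * C i).
  by apply/eqP; rewrite -subr_eq0 -/(d i); case: (unliftP ord0 i) => [i'|] ->; apply/eqP.
(* Shifting preserves leading coefficients, so those of the two sides of [di] differ only by the
   factors mu_0 and mu_i. *)
have mu_const i : mu i = mu ord0.
  have := congr1 lead_coef (di i); rewrite !lead_coefZ !lead_coefM !lead_coef_pshift.
  by move/mulIf => -> //; rewrite mulf_neq0 ?lead_coef_eq0.
have /fin_all_exists[b Cb] i : exists b, C i = b *: C ord0.
  apply: pshift_ratio_const => //; have := di i; rewrite mu_const => /(scalerI (mu0 _)).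
  by rewrite mulrC => ->; rewrite mulrC.
(* As all mu_i are equal, the p_i have distinct degrees; relation 0 divided by C_0 is a linear
   relation between them. *)
have b0 : b ord0 = 0.
  apply: (lin_indep_of_size p0) => [i j _ _|]; first by apply: inj; rewrite !mu_const.
  apply: (mulfI (C0 ord0)); rewrite mulr0 -[RHS](rel 0%N (leq0n _)) mulr_sumr.
  apply: eq_bigr => i _; rewrite expr0 scale1r pshift0 [C i]Cb.
  by rewrite -scalerAr -scalerAl.
by have := C0 ord0; rewrite Cb b0 scale0r eqxx.
Qed.

End Casoratian.

(** * Difference operators determined by a fundamental system *)

(** The index is offset by one: h m is the value under s_{m-1}, so h 0 belongs to s_{-1}. *)
Definition shift_op (L : fieldType) (n : nat) (x y z h : nat -> L) : L :=
  \sum_(j < n.+1) (x j * h j + y j * h j.+1 + z j * h j.+2).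

(** The conditions on x 0, y n + z n.-1 and z n remove h 0, h n.+1 and h n.+2. The operator then
    sees only h 1, ..., h n, and there g is a combination of the r i. *)
Lemma shift_op_eq0 (L : fieldType) n (x y z : nat -> L)
    (r : 'I_n -> nat -> L) (g : nat -> L) :
  (0 < n)%N -> x 0%N = 0 -> z n = 0 -> y n + z n.-1 = 0 ->
  (forall i, shift_op n x y z (r i) = 0) ->
  \det (\matrix_(i, j) r i j.+1) != 0 -> shift_op n x y z g = 0.
Proof.
case: n r => // k r _ x0 zk yk Er; set M := (X in \det X) => detM.
have Mu : M \in unitmx by rewrite unitmxE unitfE.
pose b := (\row_j g j.+1) *m invmx M.
pose w m := g m - \sum_i b 0 i * r i m.
have w0 (j : nat) : (j <= k)%N -> w j.+1 = 0.
  rewrite -ltnS => ltj.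
  have := congr1 (fun A : 'rV_k.+1 => A 0 (Ordinal ltj)) (mulmxKV Mu (\row_j g j.+1)).
  rewrite !mxE /= /w => <-; apply/eqP; rewrite subr_eq0; apply/eqP.
  by apply: eq_bigr => i _; rewrite !mxE.
have -> : shift_op k.+1 x y z g = shift_op k.+1 x y z w.
  have -> : shift_op k.+1 x y z w =
      shift_op k.+1 x y z g - \sum_i b 0 i * shift_op k.+1 x y z (r i).
    rewrite /shift_op /w; under [X in _ - X]eq_bigr do rewrite mulr_sumr.
    rewrite exchange_big -sumrB; apply: eq_bigr => j _ /=.
    rewrite !mulrBr !mulr_sumr.
    under [X in _ = _ - X]eq_bigr do rewrite !mulrDr.
    rewrite !big_split /=.
    under [X in _ = _ - (X + _ + _)]eq_bigr do rewrite mulrCA.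
    under [X in _ = _ - (_ + X + _)]eq_bigr do rewrite mulrCA.
    under [X in _ = _ - (_ + _ + X)]eq_bigr do rewrite mulrCA.
    ring.
  by rewrite big1 ?subr0 // => i _; rewrite Er mulr0.
rewrite /shift_op !big_split /= big_ord_recl x0 mul0r big1 => [|i _]; last first.
  by rewrite lift0 w0 ?mulr0 // -ltnS.
rewrite big_ord_recr big1 /= => [|i _]; last by rewrite w0 ?mulr0 // -ltnS.
rewrite 2!big_ord_recr big1 /= => [|i _]; last by rewrite w0 ?mulr0 // ltn_ord.
by rewrite zk !addr0 !add0r mul0r addr0 -mulrDl yk mul0r.
Qed.

(** * The two families of seed functions, treated uniformly *)

Section TaggedRows.
Variables (K : numFieldType) (a c : K).
Hypotheses (a0 : a != 0) (a1 : a != 1).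
Implicit Types (z : bool * nat) (s : seq (bool * nat)).

(* [(false, f)] stands for the function m_f^{a,c}(x) and [(true, f)] for
   a^{-x} m_f^{1/a,c}(x). *)
Definition tags (F : {fset nat} * {fset nat}) : seq (bool * nat) :=
  [seq (false, f) | f <- sort leq F.1] ++ [seq (true, f) | f <- sort leq F.2].

Definition tag_base z : K := if z.1 then a^-1 else 1.

Definition tag_poly z : {poly K} := meixner (if z.1 then a^-1 else a) c z.2.

Definition tag_eigenvalue z : K := if z.1 then - (z.2%:R + c) else z.2%:R.

Definition tag_row z : nat -> {poly K} :=
  if z.1 then row_F2 a c z.2 else row_F1 a c z.2.

Lemma rows_tags F : rows a c F = [seq tag_row z | z <- tags F].
Proof. by rewrite map_cat -!map_comp. Qed.

Lemma size_rows F : size (rows a c F) = k_of F.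
Proof. by rewrite rows_tags size_map size_cat !size_map !size_sort. Qed.

Lemma uniq_tags F : uniq (tags F).
Proof.
rewrite cat_uniq !map_inj_uniq ?sort_uniq ?fset_uniq /= ?andbT; last 2 first.
- by move=> ? ? [].
- by move=> ? ? [].
by apply/hasPn => _ /mapP[f _ ->]; apply/negP => /mapP[].
Qed.

Lemma tag_base_neq0 z : tag_base z != 0.
Proof. by rewrite /tag_base; case: ifP; rewrite ?oner_eq0 ?invr_eq0. Qed.

Lemma tag_rowE z j :
  tag_row z j = tag_base z ^+ j *: pshift j%:R (tag_poly z).
Proof.
case: z => -[] f; rewrite /tag_row /tag_base /tag_poly /=.
  by rewrite exprVn.
by rewrite expr1n scale1r.
Qed.

Lemma tag_rowS z j : tag_row z j.+1 = tag_base z *: pshift 1 (tag_row z j).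
Proof.
by rewrite !tag_rowE pshiftZ pshift_pshift nat1r scalerA exprS.
Qed.

Lemma size_tag_poly z : size (tag_poly z) = z.2.+1.
Proof.
rewrite /tag_poly size_meixner //; case: ifP; rewrite ?invr_eq0 //.
by move=> _; apply: contra a1 => /eqP e; rewrite -[a]invrK e invr1.
Qed.

Lemma tag_base_inj z z' : tag_base z = tag_base z' -> z.1 = z'.1.
Proof.
have aV : a^-1 != 1 by apply: contra a1 => /eqP e; rewrite -[a]invrK e invr1.
by rewrite /tag_base; case: z.1; case: z'.1 => // /eqP; rewrite ?(negPf aV) // eq_sym (negPf aV).
Qed.

(** Distinct tags with equal base belong to one family and so have different degrees, as
    [det_casorati_neq0] requires. *)
Lemma det_tag_rows_neq0 s :
  uniq s -> \det (rows_mx [seq tag_row z | z <- s] id) != 0.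
Proof.
move=> us; set rs := map _ s; pose tg (i : 'I_(size rs)) := nth (false, 0%N) s i.
have lt_s (i : 'I_(size rs)) : (i < size s)%N by rewrite -(size_map tag_row).
have -> : rows_mx rs id = casorati (tag_base \o tg) (tag_poly \o tg).
  by apply/matrixP => i j; rewrite !mxE (nth_map (false, 0%N)) ?tag_rowE.
apply: det_casorati_neq0 => [i|i|i j /tag_base_inj e1] /=.
- exact: tag_base_neq0.
- by rewrite -size_poly_gt0 size_tag_poly.
rewrite !size_tag_poly => -[e2]; apply/val_inj/eqP.
rewrite -(nth_uniq (false, 0%N) (lt_s i) (lt_s j) us); apply/eqP.
by move: e1 e2; rewrite /tg; case: nth => ? ?; case: nth => ? ? /= -> ->.
Qed.

(** The Meixner equation conjugated by mu^x, mu = [tag_base z]. For mu = 1/a it is a times the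
    equation with parameter 1/a; the constant c - a c left over turns the eigenvalue into -(f +
    c). *)
Lemma tag_poly_diff_eq z :
  (tag_base z)^-1 *: ('X * pshift (- 1) (tag_poly z))
  - ((1 + a) *: 'X + (a * c)%:P) * tag_poly z
  + (a * tag_base z) *: (('X + c%:P) * pshift 1 (tag_poly z))
  = (tag_eigenvalue z * (a - 1)) *: tag_poly z.
Proof.
case: z => -[] f; rewrite /tag_base /tag_poly /tag_eigenvalue /=; last first.
  by rewrite invr1 scale1r mulr1 meixner_diff_eq.
have /(congr1 ( *:%R a)) := meixner_diff_eq c f (invr_neq0 a0).
set p := meixner _ _ _; clearbody p; rewrite invrK divff // scale1r.
move: (divff a0); move: a^-1 => b ab1 e.
have -> : (- (f%:R + c) * (a - 1)) *: p =
    a *: ((f%:R * (b - 1)) *: p) + (c - a * c) *: p.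
  by rewrite scalerA -scalerDl; congr (_ *: _); ring: ab1.
by rewrite -e -!mul_polyC; ring: (congr1 polyC ab1).
Qed.

Lemma tag_row_diff_eq z j :
  ('X + j%:R%:P) * ((tag_base z)^-1 *: pshift (- 1) (tag_row z j))
  - ((1 + a) *: ('X + j%:R%:P) + (a * c)%:P) * tag_row z j
  + a *: (('X + j%:R%:P + c%:P) * tag_row z j.+1)
  = (tag_eigenvalue z * (a - 1)) *: tag_row z j.
Proof.
have := congr1 (fun q => tag_base z ^+ j *: pshift j%:R q) (tag_poly_diff_eq z).
rewrite !tag_rowE; have := tag_base_neq0 z; move: (tag_base z) => b b0.
move: (tag_poly z) => p; rewrite /pshift !(comp_polyB, comp_polyD, comp_polyM, comp_polyZ).
rewrite comp_polyX !comp_polyC -!/(pshift _ _) !pshift_pshift [_ - 1]addrC natr1 => e.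
rewrite [RHS]scalerA [_ * b ^+ j]mulrC -scalerA -e exprS.
by rewrite -!mul_polyC; ring.
Qed.

End TaggedRows.

(** * Expansion of the Casoratian along its first row *)

Section Expansion.
Variable K : numFieldType.
Implicit Types (rs : seq (nat -> {poly K})).

(** The cofactor of column j in a row placed on top of [rs], which is the coefficient of s_j in
    T. *)
Definition minor rs (j : nat) : {poly K} :=
  (-1) ^+ j * \det (rows_mx rs (bump j)).

Lemma det_rows_cons r0 rs :
  \det (rows_mx (r0 :: rs) id) = \sum_(j < (size rs).+1) r0 j * minor rs j.
Proof.
rewrite (expand_det_row _ ord0); apply: eq_bigr => j _.
rewrite mxE /cofactor add0n; congr (_ * (_ * \det _)).
by apply/matrixP => i i'; rewrite !mxE.
Qed.

Lemma det_rows_dup r0 rs :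
  (exists i : 'I_(size rs), nth (fun=> 0) rs i = r0) ->
  \det (rows_mx (r0 :: rs) id) = 0.
Proof.
case=> i ri; apply: (@determinant_alternate _ _ _ ord0 (lift ord0 i)) => //.
by move=> j; rewrite !mxE /= ri.
Qed.

Lemma minor_size rs : minor rs (size rs) = (-1) ^+ size rs * \det (rows_mx rs id).
Proof.
rewrite /minor; congr (_ * \det _); apply/matrixP => i j.
by rewrite !mxE /bump leqNgt ltn_ord.
Qed.

End Expansion.

Section FractionShift.
Variable K : numFieldType.

Lemma fshift_tofrac (l : K) (p : {poly K}) : fshift l p%:F = (pshift l p)%:F.
Proof.
have := fshift_div l p (oner_neq0 _).
by rewrite -polyC1 pshiftC polyC1 tofrac1 !divr1.
Qed.

End FractionShift.

(** * The intertwining relation and the eigenvalue *)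

Section Eigenfunctions.
Variables (K : numFieldType) (a c : K) (F : {fset nat} * {fset nat}).
Hypotheses (a0 : a != 0) (a1 : a != 1) (k_gt0 : (0 < k_of F)%N).
Implicit Types (z : bool * nat).

Local Notation Om := (Omega a c F).
Local Notation La := (Lambda a c F).
Local Notation rs := (rows a c F).
Local Notation n := (size rs).
Local Notation t := (minor rs).
Local Notation u := ((u_of F)%:R : K).

Let pi : K := \prod_(i < n) tag_base a (nth (false, 0%N) (tags F) i).

Let lt_tags (i : 'I_n) : (i < size (tags F))%N.
Proof. by rewrite -(size_map (tag_row a c)) -rows_tags. Qed.

Let nth_rows (i : 'I_n) : nth (fun=> 0) rs i = tag_row a c (nth (false, 0%N) (tags F) i).
Proof.
have := lt_tags i; case: i => i _ /= lti.
by rewrite rows_tags (nth_map (false, 0%N)).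
Qed.

Lemma Omega_neq0 : Om != 0.
Proof. by rewrite /Omega rows_tags det_tag_rows_neq0 ?uniq_tags. Qed.

(** Columns 1, ..., k are the shifts of columns 0, ..., k - 1, with row i multiplied by its base;
    [pi] collects these factors. *)
Let minor0 : t 0%N = pi *: pshift 1 Om.
Proof.
rewrite /minor expr0 mul1r -mul_polyC /pi rmorph_prod /Omega -det_pshift.
pose d := \row_(i < n) (tag_base a (nth (false, 0%N) (tags F) i))%:P.
have -> : rows_mx rs (bump 0) = diag_mx d *m map_mx (pshift 1) (rows_mx rs id).
  by apply/matrixP => i j; rewrite mul_diag_mx !mxE !nth_rows tag_rowS mul_polyC.
by rewrite det_mulmx det_diag; congr (_ * _); apply: eq_bigr => i _; rewrite mxE.
Qed.

Let minor_last : t n = (-1) ^+ n * Om.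
Proof. exact: minor_size. Qed.

Let minor_prelast : t n.-1 = (-1) ^+ n.-1 * La.
Proof. by rewrite /minor /Lambda -(size_rows a c). Qed.

Let T z : {poly K} := \det (rows_mx (tag_row a c z :: rs) id).

(** Column m - 1 of the row; index 0 supplies the column -1 reached by s_{-1}. *)
Let ext_row z m := (tag_base a z)^-1 *: pshift (- 1) (tag_row a c z m).

Let ext_rowS z m : ext_row z m.+1 = tag_row a c z m.
Proof.
rewrite /ext_row tag_rowS pshiftZ pshift_pshift addNr pshift0 scalerA.
by rewrite mulVf ?scale1r // tag_base_neq0.
Qed.

Let TE z : T z = \sum_(j < n.+1) tag_row a c z j * t j.
Proof. exact: det_rows_cons. Qed.

Let hm := h_m1 a c F.
Let h0 := h_0 a c F.
Let h1 := h_1 a c F.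

(* The coefficients of [s_{j-1}], [s_j], [s_{j+1}] that the j-th term of T
   contributes to D_F T - T (D + u). *)
Let cm (j : nat) := hm * (pshift (- 1) (t j))%:F -
  (t j)%:F * ((a - 1)^-1 *: ('X + j%:R%:P))%:F.

Let c0 (j : nat) := h0 * (t j)%:F -
  (t j)%:F * (u%:P - (a - 1)^-1 *: ((1 + a) *: ('X + j%:R%:P) + (a * c)%:P))%:F.

Let cp (j : nat) := h1 * (pshift 1 (t j))%:F -
  (t j)%:F * ((a / (a - 1)) *: ('X + j%:R%:P + c%:P))%:F.

(** This is D_F T - T (D + u) on the function of tag z, with mu^x divided out; since that function
    is an eigenfunction of D, T (D + u) acts as a multiple of T. *)
Let shift_op_tag z :
  shift_op n cm c0 cp (fun m => (ext_row z m)%:F) =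
  hm * ((tag_base a z)^-1 *: pshift (- 1) (T z))%:F + h0 * (T z)%:F
  + h1 * (tag_base a z *: pshift 1 (T z))%:F
  - ((tag_eigenvalue c z + u) *: T z)%:F.
Proof.
rewrite TE !pshift_sum !scaler_sumr !rmorph_sum /= !mulr_sumr.
rewrite -!big_split -sumrB /shift_op; apply: eq_bigr => j _ /=.
rewrite !(pshiftM _ (tag_row a c z j)) scalerAl [in X in _ = _ + X - _]scalerAl -/(ext_row z j) -tag_rowS !ext_rowS.
have e : (tag_eigenvalue c z + u) *: (tag_row a c z j * t j) =
    t j * ((a - 1)^-1 *: ('X + j%:R%:P) * ext_row z j
      + (u%:P - (a - 1)^-1 *: ((1 + a) *: ('X + j%:R%:P) + (a * c)%:P)) * tag_row a c z j
      + (a / (a - 1)) *: ('X + j%:R%:P + c%:P) * tag_row a c z j.+1).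
  have := congr1 ( *:%R (a - 1)^-1) (tag_row_diff_eq c a0 z j).
  rewrite scalerA mulrCA mulVf ?subr_eq0 // mulr1 -/(ext_row z j) => e.
  rewrite [LHS]scalerDl [tag_eigenvalue c z *: _]scalerAl -e -!mul_polyC; ring.
rewrite e /cm /c0 /cp.
move: (ext_row z j) (tag_row a c z j.+1) (tag_row a c z j).
move: (pshift (-1) (t j)) (pshift 1 (t j)) (t j) hm h0 h1.
by move=> *; ring.
Qed.

Let am1 : (a - 1)%:P%:F != 0 :> {fraction {poly K}}.
Proof. by rewrite tofrac_eq0 polyC_eq0 subr_eq0. Qed.

Let am1V : ((a - 1)^-1)%:P%:F = ((a - 1)%:P%:F)^-1.
Proof.
by apply: (mulfI am1); rewrite -tofracM -polyCM mulfV ?subr_eq0 // divff.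
Qed.

Let Om0 : Om%:F != 0.
Proof. by rewrite tofrac_eq0 Omega_neq0. Qed.

Let Om1 : (pshift 1 Om)%:F != 0.
Proof. by rewrite tofrac_eq0 pshift_eq0 Omega_neq0. Qed.

Let pshift_sign (l : K) m : pshift l ((-1) ^+ m) = (-1) ^+ m.
Proof. by rewrite /pshift rmorphXn rmorphN1. Qed.

Let cm_first : cm 0%N = 0.
Proof.
(* Here q0, q1, d, e stand for Omega(x), Omega(x + 1), a - 1 and [pi]. *)
have alg (L : fieldType) (X q0 q1 d e : L) : d != 0 -> q0 != 0 ->
    X * q1 / (d * q0) * (e * q0) - e * q1 * (d^-1 * X) = 0.
  by move=> d0 q00; field; apply/andP.
rewrite /cm minor0 pshiftZ pshift_pshift addNr pshift0 /hm /h_m1.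
rewrite addr0 -!mul_polyC !tofracM am1V.
exact: (alg {fraction {poly K}} 'X%:F _ _ _ pi%:P%:F am1 Om0).
Qed.

Let cp_last : cp n = 0.
Proof.
have alg (L : fieldType) (X b v m q0 q1 d e : L) : d != 0 -> q1 != 0 ->
    b * (X + v + m) * q0 / (d * q1) * (e * q1) - e * q0 * (b / d * (X + m + v)) = 0.
  by move=> d0 q10; field; apply/andP.
rewrite /cp minor_last pshiftM pshift_sign /h1 /h_1 -(size_rows a c).
rewrite -!mul_polyC !polyCM !tofracM !tofracD am1V.
exact: (alg {fraction {poly K}} 'X%:F a%:P%:F c%:P%:F n%:R%:P%:F _ _ _
  ((-1) ^+ n)%:F am1 Om1).
Qed.

(** The coefficient of s_k. The term of Delta at x + 1 cancels h_1 Lambda(x + 1), and the term at x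
    cancels the part of T D coming from the column k - 1. *)
Let c0_last : c0 n + cp n.-1 = 0.
Proof.
have alg (L : fieldType) (X b v m u' q0 q1 l0 l1 d e : L) :
    d != 0 -> q0 != 0 -> q1 != 0 ->
    (- (((1 + b) * (X + (m + 1)) + b * v) / d) + u'
     + (b * (X + 1 + v + (m + 1) - 1) * l1 / (d * q1)
        - b * (X + v + (m + 1) - 1) * l0 / (d * q0))) * (- e * q0)
    - - e * q0 * (u' - d^-1 * ((1 + b) * (X + (m + 1)) + b * v))
    + (b * (X + v + (m + 1)) * q0 / (d * q1) * (e * l1)
       - e * l0 * (b / d * (X + m + v))) = 0.
  by move=> d0 q00 q10; field; rewrite d0 q00 q10.
have [m nm] : exists m, n = m.+1 by exists n.-1; rewrite prednK // size_rows.
rewrite /c0 /cp minor_last minor_prelast /h0 /h_0 /h1 /h_1 /fdelta fshift_div; last first.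
  by rewrite scaler_eq0 subr_eq0 (negPf a1) Omega_neq0.
rewrite -(size_rows a c) nm /= -!mul_polyC !(pshiftM, pshiftD, pshiftX, pshiftC).
rewrite pshift_sign [pshift 1 (- 1)](pshift_sign 1 1) expr1 exprS mulN1r -natr1.
move: am1 am1V; set d := (a - 1)%:P => d0 dV; clearbody d.
rewrite !(polyCM, polyCD) polyC1 !(tofracM, tofracD, tofracN) tofrac1 dV.
rewrite !polyC_natr !rmorph_nat /=.
exact: (alg {fraction {poly K}} 'X%:F a%:P%:F c%:P%:F m%:R (u_of F)%:R
  _ _ _ _ _ ((-1) ^+ m)%:F d0 Om0 Om1).
Qed.

Let shift_op_tag_eq0 z : shift_op n cm c0 cp (fun m => (ext_row z m)%:F) = 0.
Proof.
apply: (shift_op_eq0 (r := fun i m => (ext_row (nth (false, 0%N) (tags F) i) m)%:F)).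
- by rewrite size_rows.
- exact: cm_first.
- exact: cp_last.
- exact: c0_last.
- move=> i; rewrite shift_op_tag; have -> : T (nth (false, 0%N) (tags F) i) = 0.
    by apply: det_rows_dup; exists i; rewrite nth_rows.
  by rewrite /pshift !comp_poly0 !scaler0 tofrac0 !mulr0 !addr0 subr0.
rewrite (_ : \matrix_(i, j) _ = map_mx (@FracField.tofrac _) (rows_mx rs id)).
  by rewrite det_map_mx tofrac_eq0 Omega_neq0.
by apply/matrixP => i j; rewrite !mxE ext_rowS nth_rows.
Qed.

Lemma D_op_xmeixner m : (u_of F <= m)%N ->
  D_op a c F (xmeixner a c F m)%:F = (m%:R *: xmeixner a c F m)%:F.
Proof.
move=> lem; have := shift_op_tag_eq0 (false, m - u_of F)%N.
(* The base is 1 and the eigenvalue is (m - u) + u = m. *)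
rewrite shift_op_tag /tag_base /tag_eigenvalue /= invr1 !scale1r natrB // subrK.
move/eqP; rewrite subr_eq0 => /eqP <-.
by rewrite /D_op !fshift_tofrac pshift0.
Qed.

End Eigenfunctions.

Theorem theorem3p3 (R : realType) (a c : R) (F : {fset nat} * {fset nat})
    (ha0 : a != 0) (ha1 : a != 1)
    (hc : forall i : nat, c != - i%:R)
    (hF1 : 0%N \notin F.1) (hF2 : 0%N \notin F.2)
    (hF : ~ (F.1 = fset0 /\ F.2 = fset0)) :
  Omega a c F != 0 /\
  forall n : nat, n \in sigma F ->
    poly_eigenfunction (D_op a c F) n%:R (xmeixner a c F n).
Proof.
split=> [|n]; first exact: Omega_neq0.
rewrite inE => /andP[le_u_n nF]; split.
  (* Since n - u is not in F_1, the tag of the top row is new and all tags are distinct. *)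
  rewrite /xmeixner rows_tags.
  apply: (@det_tag_rows_neq0 _ a c ha0 ha1 ((false, n - u_of F)%N :: tags F)).
  rewrite cons_uniq uniq_tags andbT mem_cat negb_or; apply/andP; split.
    apply: contra nF => /mapP[f]; rewrite mem_sort => fF [e].
    by apply/imfsetP; exists f; rewrite //= -e subnKC.
  by apply/negP => /mapP[].
apply: D_op_xmeixner => //; rewrite lt0n; apply/negP.
by rewrite /k_of addn_eq0 !cardfs_eq0 => /andP[/eqP F1 /eqP F2]; apply: hF.
Qed.
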